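(* Let $J=\{p_{1,1},\dots,p_{1,m_1},\dots,p_{n,1},\dots,p_{n,m_n}\}\subseteq L$. (1) For $1\le i\le n$ let $\varphi_i=\pm p_{i,1}\wedge\dots\wedge\pm p_{i,m_i}$ and $\psi_i=\pm q_{i,1}\wedge\dots\wedge\pm q_{i,k_i}$, and let $\varphi=(\varphi_1\wedge\psi_1)\vee\dots\vee(\varphi_n\wedge\psi_n)$. Then $M(\varphi)\uparrow J=M(\varphi_1\vee\dots\vee\varphi_n)$. (2) For $1\le i\le n$ let $\varphi_i=\pm p_{i,1}\vee\dots\vee\pm p_{i,m_i}$ and $\psi_i=\pm q_{i,1}\vee\dots\vee\pm q_{i,k_i}$, and let $\varphi=(\varphi_1\vee\psi_1)\wedge\dots\wedge(\varphi_n\vee\psi_n)$. Then $M(\varphi)\downarrow J=M(\varphi_1\wedge\dots\wedge\varphi_n)$.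
   Context: The logic is classical (two-valued) propositional logic with set of propositional variables $L$; models are functions $m:L\to\{0,1\}$ and $M(\varphi)$ is the set of models of $\varphi$. $\pm p$ stands for either $p$ or $\neg p$ (a literal). The $p_{i,j}$ and $q_{i,j}$ are propositional variables; no $q_{i,j}$ belongs to $J$; and for each fixed $i$ the variables $p_{i,1},\dots,p_{i,m_i}$ are pairwise distinct, and so are $q_{i,1},\dots,q_{i,k_i}$ (normal forms). For a set $X$ of models and $J\subseteq L$: $X\uparrow J=\{m:\ \exists m'\,(m\restriction J=m'\restriction J \text{ and } m'\in X)\}$, $X\downarrow J=\{m:\ \forall m'\,(m\restriction J=m'\restriction J \Rightarrow m'\in X)\}$. *)

(* Defs.v *)
From mathcomp Require Import all_boot.
From mathcomp Require Import boolp classical_sets.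

Set Implicit Arguments.
Unset Strict Implicit.
Unset Printing Implicit Defensive.

Local Open Scope classical_set_scope.

(* The constants [Top] and [Bot] serve as the values of the empty conjunction
   and the empty disjunction. *)
Inductive formula (L : Type) : Type :=
| Var of L
| Top
| Bot
| Neg of formula L
| And of formula L & formula L
| Or of formula L & formula L.

Arguments Top {L}.
Arguments Bot {L}.

Definition model (L : Type) := L -> bool.

Fixpoint eval (L : Type) (m : model L) (f : formula L) : bool :=
  match f with
  | Var x => m x
  | Top => true
  | Bot => false
  | Neg g => ~~ eval m g
  | And g h => eval m g && eval m h
  | Or g h => eval m g || eval m h
  end.

Definition models (L : Type) (f : formula L) : set (model L) :=
  [set m | eval m f].

(* The literal [x] if [s] is true, its negation otherwise. *)
Definition lit (L : Type) (s : bool) (x : L) : formula L :=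
  if s then Var x else Neg (Var x).

Definition agree_on (L : Type) (J : set L) (m m' : model L) : Prop :=
  forall x, J x -> m x = m' x.

Definition uparrow (L : Type) (X : set (model L)) (J : set L) : set (model L) :=
  [set m | exists m', agree_on J m m' /\ X m'].

Definition downarrow (L : Type) (X : set (model L)) (J : set L) : set (model L) :=
  [set m | forall m', agree_on J m m' -> X m'].

Notation "\AND_ ( i < n ) F" := (\big[@And _/Top]_(i < n) F)
  (at level 36, F at level 36, i, n at level 50,
   format "'[' \AND_ ( i  <  n ) '/  '  F ']'").

Notation "\OR_ ( i < n ) F" := (\big[@Or _/Bot]_(i < n) F)
  (at level 36, F at level 36, i, n at level 50,
   format "'[' \OR_ ( i  <  n ) '/  '  F ']'").

(* Main.v *)
Require Import Defs.
From mathcomp Require Import all_boot.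
From mathcomp Require Import boolp classical_sets.

Local Open Scope classical_set_scope.

(** Any model can be turned into one that satisfies every literal of [psi_i], or
    into one that falsifies every literal of [psi_i], by changing it only at the
    variables [q_(i, j)]: these lie outside [J] and are pairwise distinct, so
    their values may be prescribed freely ([reassign_outside]).  Since the
    variables of [phi_i] lie in [J], its truth value depends only on the
    restriction of the model to [J] and survives the change ([eval_lit_agree]).
    Hence quantifying over the models that agree with a given one on [J]
    existentially erases the conjunct [psi_i] from the disjunction, and
    quantifying universally erases the disjunct [psi_i] from the conjunction.
    Only one index [i] has to be treated at a time: a true disjunct is enough
    to verify a disjunction, a false conjunct to refute a conjunction; so
    variables shared between different [psi_i] cause no conflict. *)

Lemma eval_bigAND (L : Type) (v : model L) (n : nat) (F : 'I_n -> formula L) :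
  eval v (\AND_(i < n) (F i)) = [forall i, eval v (F i)].
Proof. by rewrite (big_morph (eval v) (op1 := andb) (id1 := true)) // big_andE. Qed.

Lemma eval_bigOR (L : Type) (v : model L) (n : nat) (F : 'I_n -> formula L) :
  eval v (\OR_(i < n) (F i)) = [exists i, eval v (F i)].
Proof. by rewrite (big_morph (eval v) (op1 := orb) (id1 := false)) // big_orE. Qed.

Lemma eval_lit (L : Type) (v : model L) (s : bool) (x : L) :
  eval v (lit s x) = (v x == s).
Proof. by case: s => /=; case: (v x). Qed.

Lemma eval_lit_agree (L : Type) (J : set L) (v v' : model L) (s : bool) (x : L) :
  agree_on J v v' -> J x -> eval v (lit s x) = eval v' (lit s x).
Proof. by move=> vv' Jx; rewrite !eval_lit vv'. Qed.

(** Injectivity of [q] makes the prescription [q j |-> b j] consistent. *)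
Lemma reassign_outside (L : Type) (J : set L) (v : model L) (k : nat)
    (q : 'I_k -> L) (b : 'I_k -> bool) :
  injective q -> (forall j, ~ J (q j)) ->
  exists v', agree_on J v v' /\ forall j, v' (q j) = b j.
Proof.
move=> q_inj qJ.
exists (fun x => if pselect (exists j, q j = x) is left h
                 then b (projT1 (cid h)) else v x).
split=> [x Jx | j].
  by case: pselect => // -[j qj]; case: (qJ j); rewrite qj.
case: pselect => [h | []]; last by exists j.
by case: (cid h) => j' /= /q_inj ->.
Qed.

Theorem fact1p5p2 (L : Type) (n : nat) (m k : 'I_n -> nat)
    (p : forall i : 'I_n, 'I_(m i) -> L) (q : forall i : 'I_n, 'I_(k i) -> L)
    (J : set L)
    (J_def : J = [set x | exists (i : 'I_n) (j : 'I_(m i)), x = p i j])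
    (p_inj : forall i, injective (p i))
    (q_inj : forall i, injective (q i))
    (q_notin_J : forall (i : 'I_n) (j : 'I_(k i)), ~ J (q i j)) :
  (forall (s : forall i : 'I_n, 'I_(m i) -> bool)
          (t : forall i : 'I_n, 'I_(k i) -> bool)
          (phi psi : 'I_n -> formula L),
      (forall i, phi i = \AND_(j < m i) (lit (s i j) (p i j))) ->
      (forall i, psi i = \AND_(j < k i) (lit (t i j) (q i j))) ->
      uparrow (models (\OR_(i < n) (And (phi i) (psi i)))) J
      = models (\OR_(i < n) (phi i)))
  /\
  (forall (s : forall i : 'I_n, 'I_(m i) -> bool)
          (t : forall i : 'I_n, 'I_(k i) -> bool)
          (phi psi : 'I_n -> formula L),
      (forall i, phi i = \OR_(j < m i) (lit (s i j) (p i j))) ->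
      (forall i, psi i = \OR_(j < k i) (lit (t i j) (q i j))) ->
      downarrow (models (\AND_(i < n) (Or (phi i) (psi i)))) J
      = models (\AND_(i < n) (phi i))).
Proof.
have Jp i j : J (p i j) by rewrite J_def; exists i, j.
split=> s t phi psi phiE psiE; apply/seteqP; split=> v; rewrite /models /=.
- case=> v' [vv'] /=; rewrite !eval_bigOR => /existsP[i /= /andP[phi_i _]].
  apply/existsP; exists i; move: phi_i; rewrite phiE !eval_bigAND.
  move=> /forallP phi_i; apply/forallP=> j.
  by rewrite (eval_lit_agree _ _ _ _ _ _ vv').
- rewrite eval_bigOR => /existsP[i phi_i].
  have [v' [vv' v'q]] :=
    reassign_outside _ J v _ (q i) (t i) (q_inj i) (q_notin_J i).
  exists v'; split=> //=; rewrite eval_bigOR; apply/existsP; exists i => /=.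
  move: phi_i; rewrite phiE psiE !eval_bigAND => /forallP phi_i.
  apply/andP; split; apply/forallP=> j; last by rewrite eval_lit v'q.
  by rewrite -(eval_lit_agree _ _ _ _ _ _ vv').
- move=> all_v'; rewrite eval_bigAND; apply/forallP=> i.
  (* Falsifying every literal of [psi i] leaves only [phi i] to hold. *)
  have [v' [vv' v'q]] :=
    reassign_outside _ J v _ (q i) (fun j => ~~ t i j) (q_inj i) (q_notin_J i).
  have := all_v' v' vv'; rewrite /= eval_bigAND => /forallP /(_ i) /=.
  rewrite phiE psiE !eval_bigOR => /orP[] /existsP[j /=].
    rewrite -(eval_lit_agree _ _ _ _ _ _ vv') // => phi_ij.
    by apply/existsP; exists j.
  by rewrite eval_lit v'q; case: (t i j).
- rewrite eval_bigAND => /forallP phi_v v' vv' /=.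
  rewrite eval_bigAND; apply/forallP=> i /=; apply/orP; left.
  have := phi_v i; rewrite phiE !eval_bigOR => /existsP[j phi_ij].
  by apply/existsP; exists j; rewrite -(eval_lit_agree _ _ _ _ _ _ vv').
Qed.
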